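(* Consider the plant-sensor-channel-controller model described in the context, with plant dynamics $\dot x=Ax+Bu+w$, estimator dynamics $\dot{\hat x}=A\hat x+Bu$ between receptions, triggering strategy $|z(t)|=J$, and jump strategy $\hat x(t_c^+)=\bar z(t_c)+\hat x(t_c)$. Assume the pair $(A,B)$ is stabilizable. If the controller has enough information about $x(0)$ such that the state estimation error satisfies $|z(0)|<J$, with $J>\frac{M}{A\rho_0}(e^{A\gamma}-1)$, and if the sensor uses the quantization policy $\mathcal{Q}$ described in the context, then there exist a time $T_0$ and a real number $\kappa$ such that $|x(t)|\le\kappa$ for all $t\ge T_0$, provided that the packet size is lower bounded by $$g(t_s^k)\ \ge\ \max\left\{0,\ 1+\log_2\frac{Ab\gamma}{\ln\left(1+\frac{\rho_0-\frac{M}{JA}(e^{A\gamma}-1)}{e^{A\gamma}}\right)}\right\},\quad k\in\mathbb{N}.$$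
   Context: Model. The plant is the scalar system $\dot x(t)=Ax(t)+Bu(t)+w(t)$, $t\ge0$, with $A>0$, $B\in\mathbb{R}$, state $x(t)\in\mathbb{R}$, control input $u(t)\in\mathbb{R}$ and disturbance $w(t)\in\mathbb{R}$ with $|w(t)|\le M$, $M>0$; the initial condition satisfies $|x(0)|\le L$ for some $L>0$. The sensor measures the state exactly. The input $u$ is chosen by the controller, which acts with infinite precision and without delay; the statement does not prescribe a particular control law. At triggering times $t_s^k$ ($k\in\mathbb{N}$) the sensor sends a packet of $g(t_s^k)$ bits, which the controller receives entirely and without error, and decodes, at the reception time $t_c^k$; the delay $t_c^k-t_s^k$ is unknown and lies in $[0,\gamma]$, where $\gamma\ge0$ is finite. The superscript $k$ is dropped for a generic triggering time $t_s$ and its reception time $t_c$. The sensor is assumed to know the times at which the actuator performs the control action, so that it can also compute $\hat x(t)$ for all $t$. Estimator and jump. The controller's estimate $\hat x$ starts at $\hat x(0)=\hat x_0$ and satisfies $\dot{\hat x}=A\hat x+Bu$ between consecutive reception times; at each reception time it is updated by $\hat x(t_c^+)=\bar z(t_c)+\hat x(t_c)$, where $f(t^+)$ denotes the right-hand limit. The state estimation error is $z(t)=x(t)-\hat x(t)$, so $z(0)=x(0)-\hat x_0$ and $z(t_c^+)=z(t_c)-\bar z(t_c)$. Triggering. A triggering event occurs when $|z(t)|=J$, where $J>0$. Packets and quantization. At a triggering time $t_s$ the sensor sends a packet of $g(t_s)$ bits consisting of the sign of $z(t_s)$ and a quantized version $q(t_s)$ of $t_s$. Using the bound $\gamma$ on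 the delay and the decoded packet, the controller reconstructs $q(t_s)$ and sets $\bar z(t_c)=\mathrm{sign}(z(t_s))\,J\,e^{A(t_c-q(t_s))}$. A quantization policy is a rule for this encoding and decoding. The constant $0<\rho_0<1$ is a design parameter, and $b>1$. The policy $\mathcal{Q}$. An existence result for this model asserts that, if $|z(0)|<J$ and $J>\frac{M}{A\rho_0}(e^{A\gamma}-1)$, there exists a quantization policy which, with packet sizes satisfying the lower bound displayed in the claim, achieves $|z(t_c^{k+})|=|z(t_c^k)-\bar z(t_c^k)|\le\rho_0J$ for all $k\in\mathbb{N}$ and all possible $t_c^k\in[t_s^k,t_s^k+\gamma]$. $\mathcal{Q}$ denotes the particular policy provided by that result. For $\gamma=0$ the logarithm is read as $-\infty$, so that the lower bound is $0$. *)

(* Defs.v *)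
From HB Require Import structures.
From mathcomp Require Import all_boot all_order all_algebra.
From mathcomp Require Import all_classical all_reals all_analysis.

Set Implicit Arguments.
Unset Strict Implicit.
Unset Printing Implicit Defensive.

Import Order.TTheory GRing.Theory Num.Theory.
Import numFieldNormedType.Exports.

Local Open Scope classical_set_scope.
Local Open Scope ring_scope.

(* The scalar closed-loop matrix [A - B * K] is Hurwitz iff it is negative. *)
Definition stabilizable (R : realType) (A B : R) : Prop :=
  exists K : R, A - B * K < 0.

(* Integral (Caratheodory) form of [y' = f] on [`[s, t]]: the right-hand side
   contains a disturbance that is only measurable, so [y] need not be
   differentiable everywhere. *)
Definition evolves (R : realType) (y f : R -> R) (s t : R) : Prop :=
  lebesgue_measure.-integrable `[s, t] (EFin \o f) /\
  y t = y s + \int[lebesgue_measure]_(r in `[s, t]) f r.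

(* One bit of a [g]-bit packet carries the sign of the estimation error, so
   [g.-1] bits are left for the triggering time; for [g = 0] and for [g = 1]
   nothing but the sign is sent.  The decoder also sees the reception time. *)
Record quantization_policy (R : realType) := QuantizationPolicy {
  encode : forall g : nat, R -> (g.-1).-tuple bool;
  decode : forall g : nat, (g.-1).-tuple bool -> R -> R }.

(* [trig k] says that a [k]-th triggering event takes place (there may be
   finitely many, or none); [ts k], [tc k] and [psize k] are the corresponding
   triggering time, reception time and packet size, and are irrelevant when
   [trig k] does not hold.  All signals matter on [0 <= t] only. *)
Record signals (R : realType) := Signals {
  state : R -> R;
  estimate : R -> R;
  input : R -> R;
  noise : R -> R;
  trig : set nat;
  ts : nat -> R;
  tc : nat -> R;
  psize : nat -> nat }.

Definition error (R : realType) (e : signals R) (t : R) : R :=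
  state e t - estimate e t.

Definition decoded_time (R : realType) (Q : quantization_policy R)
    (e : signals R) (k : nat) : R :=
  decode Q (encode Q (psize e k) (ts e k)) (tc e k).

Definition zbar (R : realType) (A J : R) (Q : quantization_policy R)
    (e : signals R) (k : nat) : R :=
  Num.sg (error e (ts e k)) * J * expR (A * (tc e k - decoded_time Q e k)).

(* The value of [estimate] (hence of [error]) at a reception time is the one
   before the jump. *)
Record execution (R : realType) (A B M L gamma J : R)
    (Q : quantization_policy R) (e : signals R) : Prop := Execution {
  initial_state : `|state e 0| <= L;
  disturbance_measurable : measurable_fun `[(0 : R), +oo[ (noise e);
  disturbance_bounded : forall t, 0 <= t -> `|noise e t| <= M;
  plant : forall s t, 0 <= s -> s <= t ->
    evolves (state e) (fun r => A * state e r + B * input e r + noise e r) s t;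
  estimator : forall s t, 0 <= s -> s <= t ->
    (forall k, trig e k -> ~ (s <= tc e k < t)) ->
    evolves (estimate e) (fun r => A * estimate e r + B * input e r) s t;
  jump : forall k, trig e k ->
    estimate e r @[r --> (tc e k)^'+] --> zbar A J Q e k + estimate e (tc e k);
  trig_initial : forall k, trig e k.+1 -> trig e k;
  trigger : forall k, trig e k -> 0 <= ts e k /\ `|error e (ts e k)| = J;
  (* Every crossing of the threshold triggers, except while a packet is in
     flight: the next triggering time is the first one after the reception. *)
  trigger_all : forall t, 0 <= t -> `|error e t| = J ->
    exists2 k, trig e k & ts e k <= t <= tc e k;
  trigger_after_reception : forall k, trig e k.+1 -> tc e k < ts e k.+1;
  delay : forall k, trig e k -> ts e k <= tc e k <= ts e k + gamma }.

Definition log2 (R : realType) (r : R) : R := ln r / ln 2.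

(* [ln 0 = 0] in the library, whereas the bound reads [log2 0] as [-oo]. *)
Definition packet_bound (R : realType) (A M gamma J rho0 b : R) : R :=
  if gamma == 0 then 0 else
  Num.max 0
    (1 + log2 (A * b * gamma /
               ln (1 + (rho0 - M / (J * A) * (expR (A * gamma) - 1))
                       / expR (A * gamma)))).

Definition packets_large_enough (R : realType) (A M gamma J rho0 b : R)
    (e : signals R) : Prop :=
  forall k, trig e k -> packet_bound A M gamma J rho0 b <= (psize e k)%:R.

(* The property characterizing the policy used by the sensor.  It is required
   for every input signal, disturbance, delays and packet sizes; the
   left-hand side is the norm of the right limit of [error] at [tc e k]. *)
Definition achieves (R : realType) (A B M L gamma J rho0 b : R)
    (Q : quantization_policy R) : Prop :=
  forall e : signals R, execution A B M L gamma J Q e ->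
    `|error e 0| < J ->
    packets_large_enough A M gamma J rho0 b e ->
    forall k, trig e k -> `|error e (tc e k) - zbar A J Q e k| <= rho0 * J.

(* Main.v *)
(* The feedback [u = - K xhat] with [A - B K < 0] turns the plant into
   [x' = (A - B K) x + (B K z + w)], so [x] is bounded as soon as the error [z]
   is.  A received packet brings [|z|] below a constant smaller than [J]; by
   Gronwall's inequality for [z' = A z + w], [z] then needs a time bounded below
   to reach [J] again, so receptions do not accumulate and every time has a
   last reception before it.  From that reception on, either the threshold is
   not crossed, whence [|z| < J] by continuity, or a packet is in flight, whence
   [z] has grown from [J] for at most [gamma]. *)

Require Import Defs.
From HB Require Import structures.
From mathcomp Require Import all_boot all_order all_algebra.
From mathcomp Require Import all_classical all_reals all_analysis.
From mathcomp Require Import ring lra.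

Set Implicit Arguments.
Unset Strict Implicit.
Unset Printing Implicit Defensive.

Import Order.TTheory GRing.Theory Num.Theory.
Import numFieldNormedType.Exports.

Local Open Scope classical_set_scope.
Local Open Scope ring_scope.

(** * Evolutions in integral form: continuity, exponential growth, barriers *)

Lemma within_continuous_norm (R : realType) (y : R -> R) (D : set R) :
  {within D, continuous y} -> {within D, continuous (fun r => `|y r|)}.
Proof. by move=> cy x; apply: continuous_comp; [exact: cy|exact: norm_continuous]. Qed.

(** On the segment [y] is a constant plus the indefinite integral of an integrable function, and
    such an integral is continuous in its upper end. *)
Lemma evolves_within_continuous (R : realType) (y f : R -> R) (s t : R) :
  s <= t -> (forall r, s <= r <= t -> evolves y f s r) ->
  {within `[s, t], continuous y}.
Proof.
move=> st evo.
have [intf _] : evolves y f s t by apply: evo; rewrite st lexx.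
have cF := parameterized_integral_continuous st intf.
apply/subspace_continuousP => x xst.
have yE r : `[s, t]%classic r -> y r = y s + \int[lebesgue_measure]_(r in `[s, r]) f r.
  by rewrite /= in_itv/= => /evo[].
rewrite /from_subspace (yE x)//.
apply: (@cvg_trans _ ((fun x => y s + \int[lebesgue_measure]_(r in `[s, x]) f r)
    @ within `[s, t] (nbhs x))).
  apply: near_eq_cvg; near=> r.
  by rewrite (yE r)//; near: r; exact: withinT.
apply: cvgD; first exact: cvg_cst.
by move/subspace_continuousP : cF => /(_ x xst).
Unshelve. all: by end_near. Qed.

Lemma evolves_opp (R : realType) (y f : R -> R) (s t : R) :
  evolves y f s t -> evolves (fun r => - y r) (fun r => - f r) s t.
Proof.
move=> [intf yE]; split.
  rewrite (_ : _ \o _ = (fun x => - (EFin \o f) x)%E); last exact/funext.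
  exact: integrableN.
rewrite yE opprD; congr (_ + _).
under [RHS]eq_Rintegral do rewrite -mulN1r.
by rewrite RintegralZl// mulN1r.
Qed.

Lemma evolvesB (R : realType) (y f y' f' g : R -> R) (s t : R) :
  (forall r, f r - f' r = g r) ->
  evolves y f s t -> evolves y' f' s t -> evolves (fun r => y r - y' r) g s t.
Proof.
move=> fg [intf yE] [intf' yE'].
have -> : g = (fun r => f r - f' r) by apply/funext => r; rewrite fg.
split; last by rewrite yE yE' RintegralB//; ring.
rewrite (_ : _ \o _ = (EFin \o f) \- (EFin \o f'))%E; last exact/funext.
exact: integrableB.
Qed.

(** The majorant [V] of [v] is differentiable although [v] need not be, and [V' = A v <= A V]; hence
    [V] times the integrating factor [expR (- A * r)] does not increase. *)
Lemma gronwall (R : realType) (A c : R) (v : R -> R) (s t : R) :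
  0 <= A -> s <= t -> {within `[s, t], continuous v} ->
  (forall r, s <= r <= t ->
    v r <= c + A * \int[lebesgue_measure]_(x in `[s, r]) v x) ->
  v t <= c * expR (A * (t - s)).
Proof.
move=> A0 st cv vle.
have intv : lebesgue_measure.-integrable `[s, t] (EFin \o v).
  by apply: continuous_compact_integrable => //; exact: segment_compact.
pose V r := c + A * \int[lebesgue_measure]_(x in `[s, r]) v x.
have cV : {within `[s, t], continuous V}.
  have cF := parameterized_integral_continuous st intv.
  move=> x; apply: cvgD; first exact: cvg_cst.
  by apply: cvgM; [exact: cvg_cst|exact: cF].
have dV x : x \in `]s, t[ -> is_derive x 1 V (A * v x).
  rewrite in_itv/= => /andP[sx xt].
  have [] := continuous_FTC1_closed xt intv sx.
    apply: within_continuous_continuous cv _; first exact: lt_trans xt.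
    by rewrite in_itv/= sx.
  rewrite derive1E => /derivableP dF dFE.
  rewrite /V; apply: is_derive_eq.
  by rewrite dFE /GRing.scale/=; ring.
pose W r := V r * expR (- A * r).
have dW x : x \in `]s, t[ -> is_derive x 1 W ((A * v x - A * V x) * expR (- A * x)).
  move=> /dV dVx; rewrite /W; apply: is_derive_eq.
  by rewrite /GRing.scale/=; ring.
have cW : {within `[s, t], continuous W}.
  have cE : continuous (fun r : R => expR (- A * r)).
    by move=> r; apply: continuous_comp; [exact: mulrl_continuous|exact: continuous_expR].
  by move=> x; apply: cvgM; [exact: cV|exact: continuous_subspaceT cE x].
have WtWs : W t <= W s.
  apply: (@ler0_derive1_le_cc _ W s t) => //; rewrite ?in_itv/= ?lexx ?st//.
  - by move=> x /dW[].
  - move=> x xst; rewrite derive1E; have -> := @derive_val _ _ _ _ _ _ _ (dW x xst).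
    rewrite mulr_le0_ge0 ?expR_ge0// -mulrBr mulr_ge0_le0// subr_le0 vle//.
    by move: xst; rewrite in_itv/= => /andP[/ltW -> /ltW ->].
(* The integral over the singleton [[s, s]] vanishes. *)
have Vs : V s = c by rewrite /V set_itv1 Rintegral_set1 mulr0 addr0.
have -> : c * expR (A * (t - s)) = W s * expR (A * t).
  by rewrite /W Vs -mulrA -expRD; congr (_ * expR _); ring.
apply: (le_trans (vle t _)); first by rewrite st lexx.
rewrite -/(V t) (_ : V t = W t * expR (A * t)).
  by rewrite ler_wpM2r ?expR_ge0.
by rewrite /W -mulrA -expRD (_ : - A * t + A * t = 0) ?expR0 ?mulr1//; ring.
Qed.

(** Shifting [|y|] by [M / A] absorbs the constant term, since [A * |y| + M = A * (|y| + M / A)];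
    the homogeneous Gronwall inequality then applies to the shifted norm. *)
Lemma evolves_growth (R : realType) (y f : R -> R) (A M s t : R) :
  0 < A -> s <= t -> (forall r, s <= r <= t -> evolves y f s r) ->
  (forall r, s <= r <= t -> `|f r| <= A * `|y r| + M) ->
  `|y t| + M / A <= (`|y s| + M / A) * expR (A * (t - s)).
Proof.
move=> A0 st evo fle.
have cy := evolves_within_continuous st evo.
have cv : {within `[s, t], continuous (fun r => `|y r| + M / A)}.
  by move=> x; apply: cvgD; [exact: within_continuous_norm|exact: cvg_cst].
apply: (@gronwall _ A _ (fun r => `|y r| + M / A)) => //; first exact: ltW.
move=> r /andP[sr rt].
have [intf ->] : evolves y f s r by apply: evo; rewrite sr.
have intv : lebesgue_measure.-integrable `[s, r] (EFin \o (fun r => `|y r| + M / A)).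
  apply: continuous_compact_integrable; first exact: segment_compact.
  by apply: continuous_subspaceW cv; apply: subset_itvl; rewrite bnd_simp.
rewrite addrAC lerD2r; apply: (le_trans (ler_normD _ _)); rewrite lerD2l.
apply: (le_trans (le_normr_Rintegral _ intf)) => //.
rewrite -RintegralZl//; apply: le_Rintegral => //.
- exact: (integrable_norm intf).
- rewrite (_ : _ \o _ =
      (fun x => A%:E * (EFin \o (fun r => `|y r| + M / A)%R) x)%E); last exact/funext.
  exact: integrableZl.
- move=> x /=; rewrite in_itv/= => /andP[sx xr].
  apply: (le_trans (fle x _)); first by rewrite sx (le_trans xr).
  by rewrite mulrDr mulrCA divff ?gt_eqF// mulr1.
Qed.

(** No derivative of [y] is available, so the argument integrates from the last time [p] at which
    [y <= c]: after [p] the solution lies above [c], where the integrand is nonpositive, so it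
    cannot have risen. *)
Lemma evolves_barrier (R : realType) (y f : R -> R) (c s t : R) :
  s <= t ->
  (forall p r, s <= p -> p <= r -> r <= t -> evolves y f p r) ->
  (forall r, s <= r <= t -> c <= y r -> f r <= 0) ->
  y s <= c -> y t <= c.
Proof.
move=> st evo f0 ysc; rewrite leNgt; apply/negP => cyt.
have cy : {within `[s, t], continuous y}.
  apply: evolves_within_continuous st _ => r /andP[sr rt].
  exact: evo.
pose S := [set r | s <= r <= t /\ y r <= c].
have S0 : S s by rewrite /S/= lexx st.
have supS : has_sup S by split; [exists s|exists t => r [/andP[]]].
have spt : s <= sup S <= t.
  by rewrite ub_le_sup//= ?ge_sup//; [exists s|move=> r [/andP[]]|exact: supS.2].
have gtS r : sup S < r -> r <= t -> c < y r.
  move=> Sr rt; rewrite ltNge; apply/negP => yrc.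
  have : S r by split=> //; rewrite rt andbT (le_trans _ (ltW Sr))//; case/andP: spt.
  by move/(ub_le_sup supS.2); rewrite leNgt Sr.
have [p [/andP[sp pt] ypc gtp]] : exists p, [/\ s <= p <= t, y p <= c &
    forall r, p < r -> r <= t -> c <= y r].
  exists (sup S); split => //; last by move=> r Sr rt; exact/ltW/gtS.
  (* The supremum belongs to [S]: otherwise continuity would give [c < y] on a whole neighbourhood
     of [sup S], which contains points of [S]. *)
  rewrite leNgt; apply/negP => cyp.
  have : \forall r \near within `[s, t] (nbhs (sup S)), c < y r.
    move/subspace_continuousP : cy => /(_ (sup S)) cyS.
    by apply: (cvgr_gt (y (sup S)) (cyS _)) => //; rewrite /= in_itv/= sp.
  rewrite /within/= => /nbhs_ballP[e/= e0 eS].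
  have [r [/= srt yrc] Sr] := sup_adherent e0 supS.
  have rS : r <= sup S by apply: ub_le_sup; [exact: supS.2|].
  suff : c < y r by rewrite ltNge yrc.
  apply: eS; last by rewrite /= in_itv.
  by rewrite /ball/= ger0_norm ?subr_ge0// ltrBlDl -ltrBlDr.
have [intf ytE] := evo p t sp pt (lexx t).
have : y t <= y p; last by move=> /le_trans/(_ ypc); rewrite leNgt cyt.
(* The left end is dropped from the interval, because [c <= y r] is known only for [p < r]. *)
rewrite ytE gerDl -Rintegral_itv_obnd_cbnd; last first.
  by apply: integrableS intf => //; apply: subset_itvr; rewrite bnd_simp.
rewrite -oppr_ge0 -mulN1r -RintegralZl//; last first.
  by apply: integrableS intf => //; apply: subset_itvr; rewrite bnd_simp.
apply: Rintegral_ge0 => r /=; rewrite in_itv/= => /andP[pr rt].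
by rewrite mulN1r oppr_ge0 f0 ?gtp// rt andbT (le_trans sp (ltW pr)).
Qed.

(** * Order of triggerings and receptions, and the error between receptions *)

(** The interval is half-open because signals keep their pre-jump value at a reception time: a
    reception at [t] does not disturb the evolution up to [t], whereas one at [s] does. *)
Definition quiet (R : realType) (e : signals R) (s t : R) : Prop :=
  forall k, trig e k -> ~ (s <= tc e k < t).

Lemma trig_leq (R : realType) (A B M L gamma J : R) (Q : quantization_policy R)
    (e : signals R) (i k : nat) :
  execution A B M L gamma J Q e -> (i <= k)%N -> trig e k -> trig e i.
Proof.
move=> ex; elim: k => [|k IHk]; first by rewrite leqn0 => /eqP ->.
by rewrite leq_eqVlt => /predU1P[->//|/IHk ik /(trig_initial ex)].
Qed.

Lemma reception_lt_trigger (R : realType) (A B M L gamma J : R)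
    (Q : quantization_policy R) (e : signals R) (i k : nat) :
  execution A B M L gamma J Q e -> (i < k)%N -> trig e k -> tc e i < ts e k.
Proof.
move=> ex; elim: k => // k IHk; rewrite ltnS leq_eqVlt => /predU1P[-> tk|ik tk].
  exact: (trigger_after_reception ex).
have tk' := trig_initial ex tk.
apply: lt_trans (trigger_after_reception ex tk).
apply: lt_le_trans (IHk ik tk') _.
by case/andP: (delay ex tk').
Qed.

Lemma reception_mono (R : realType) (A B M L gamma J : R)
    (Q : quantization_policy R) (e : signals R) (i k : nat) :
  execution A B M L gamma J Q e -> (i <= k)%N -> trig e k -> tc e i <= tc e k.
Proof.
move=> ex; rewrite leq_eqVlt => /predU1P[->//|ik tk].
apply: ltW (lt_le_trans (reception_lt_trigger ex ik tk) _).
by case/andP: (delay ex tk).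
Qed.

(** The input enters plant and estimator alike and cancels in the difference, so the error dynamics
    is the same for every control law. *)
Lemma error_evolves (R : realType) (A B M L gamma J : R)
    (Q : quantization_policy R) (e : signals R) (s t : R) :
  execution A B M L gamma J Q e -> 0 <= s -> s <= t -> quiet e s t ->
  evolves (error e) (fun r => A * error e r + noise e r) s t.
Proof.
move=> ex s0 st q; rewrite /error.
by apply: evolvesB (plant ex s0 st) (estimator ex s0 st q) => r; ring.
Qed.

Lemma error_growth (R : realType) (A B M L gamma J : R)
    (Q : quantization_policy R) (e : signals R) (s t : R) :
  0 < A -> execution A B M L gamma J Q e -> 0 <= s -> s <= t -> quiet e s t ->
  `|error e t| + M / A <= (`|error e s| + M / A) * expR (A * (t - s)).
Proof.
move=> A0 ex s0 st q.
apply: (@evolves_growth _ _ (fun r => A * error e r + noise e r)) => //.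
- move=> r /andP[sr rt]; apply: (error_evolves ex) => // k tk /andP[sk kr].
  by apply: (q k tk); rewrite sk (lt_le_trans kr).
- move=> r /andP[sr rt]; apply: (le_trans (ler_normD _ _)); rewrite normrM gtr0_norm//.
  by rewrite lerD2l (disturbance_bounded ex)// (le_trans s0).
Qed.

(** * Behaviour just after a reception, and non-accumulation of receptions *)

(** Only the estimate jumps: the state is continuous, so the right limit of the error is its
    pre-jump value minus [zbar]. The strict bound on this limit persists on a right
    neighbourhood. *)
Lemma error_after_reception (R : realType) (A B M L gamma J eta : R)
    (Q : quantization_policy R) (e : signals R) (k : nat) :
  execution A B M L gamma J Q e -> trig e k ->
  `|error e (tc e k) - zbar A J Q e k| < eta ->
  \forall s \near (tc e k)^'+, `|error e s| < eta.
Proof.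
move=> ex tk; have tck0 : 0 <= tc e k.
  by have [/le_trans + _] := trigger ex tk; apply; case/andP: (delay ex tk).
have cx : state e r @[r --> (tc e k)^'+] --> state e (tc e k).
  have lt1 : tc e k < tc e k + 1 by rewrite ltrDl.
  have /(continuous_within_itvP _ lt1)[] // : {within `[tc e k, tc e k + 1], continuous (state e)}.
  apply: evolves_within_continuous (ltW lt1) _ => r /andP[kr _].
  exact: (plant ex).
have cz : error e r @[r --> (tc e k)^'+] --> error e (tc e k) - zbar A J Q e k.
  rewrite (_ : _ - _ = state e (tc e k) - (zbar A J Q e k + estimate e (tc e k))).
    exact: cvgB cx (jump ex tk).
  by rewrite /error; ring.
by move=> lteta; apply: (cvgr_norm_lt _ cz).
Qed.

(** The left-hand side of the conclusion is the time that [z' = A z + M] takes to grow from [eta] to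
    [J]. *)
Lemma dwell_time (R : realType) (A B M L gamma J eta : R)
    (Q : quantization_policy R) (e : signals R) (k : nat) :
  0 < A -> 0 < M -> 0 < J -> 0 < eta ->
  execution A B M L gamma J Q e -> trig e k.+1 ->
  `|error e (tc e k) - zbar A J Q e k| < eta ->
  ln ((J + M / A) / (eta + M / A)) / A <= ts e k.+1 - tc e k.
Proof.
move=> A0 M0 J0 eta0 ex tk1 lteta.
have tk := trig_initial ex tk1.
have kk1 := trigger_after_reception ex tk1.
have tck0 : 0 <= tc e k.
  by have [/le_trans + _] := trigger ex tk; apply; case/andP: (delay ex tk).
have [ts0 tsJ] := trigger ex tk1.
(* The error at [tc e k] itself is the value before the jump, so the growth estimate has to start
   slightly later. *)
near (tc e k)^'+ => s.
have ks : tc e k < s by near: s; exact: nbhs_right_gt.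
have sk1 : s < ts e k.+1 by near: s; exact: nbhs_right_lt.
have zs : `|error e s| < eta by near: s; exact: error_after_reception ex tk lteta.
have := error_growth A0 ex (le_trans tck0 (ltW ks)) (ltW sk1).
rewrite tsJ ler_pdivrMr// => growth.
have {growth} JM : J + M / A <= (eta + M / A) * expR (A * (ts e k.+1 - tc e k)).
  apply: le_trans (growth _) _.
    move=> i ti /andP[si ik1].
    (* No reception falls between [s] and the next triggering: those of index at most [k] precede
       [s], the others come no earlier than [ts e k.+1]. *)
    have [ik|ki] := leqP i k.
      by have := reception_mono ex ik tk; rewrite leNgt (lt_le_trans ks).
    have := reception_mono ex ki ti; case/andP: (delay ex tk1) => + _.
    by move=> /le_trans/[apply]; rewrite leNgt ik1.
  apply: ler_pM => //.
  - by rewrite addr_ge0// divr_ge0 ?ltW.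
  - by rewrite lerD2r ltW.
  - by rewrite ler_expR ler_pM2l// lerD2l lerN2 ltW.
rewrite -ler_expR lnK ?posrE ?divr_gt0 ?ler_pdivrMr ?addr_gt0 ?divr_gt0//.
by rewrite [leRHS]mulrC [_ * A]mulrC.
Unshelve. all: by end_near. Qed.

Lemma reception_ge (R : realType) (A B M L gamma J eta : R)
    (Q : quantization_policy R) (e : signals R) :
  0 < A -> 0 < M -> 0 < eta < J -> execution A B M L gamma J Q e ->
  (forall k, trig e k -> `|error e (tc e k) - zbar A J Q e k| < eta) ->
  forall k, trig e k ->
    k%:R * (ln ((J + M / A) / (eta + M / A)) / A) <= tc e k.
Proof.
move=> A0 M0 /andP[eta0 etaJ] ex lteta; elim=> [|k IHk] tk.
  rewrite mul0r; have [/le_trans + _] := trigger ex tk; apply.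
  by case/andP: (delay ex tk).
have tk' := trig_initial ex tk.
have J0 := lt_trans eta0 etaJ.
have := dwell_time A0 M0 J0 eta0 ex tk (lteta _ tk').
have := IHk tk'; case/andP: (delay ex tk) => + _.
set tau := _ / A; rewrite -natr1 mulrDl mul1r; lra.
Qed.

(** By [reception_ge] the index of a reception before [t] is at most [t / tau], where [tau] is the
    dwell time; a bounded nonempty set of indices has a maximum. *)
Lemma last_reception (R : realType) (A B M L gamma J eta : R)
    (Q : quantization_policy R) (e : signals R) (t : R) :
  0 < A -> 0 < M -> 0 < eta < J -> execution A B M L gamma J Q e ->
  (forall k, trig e k -> `|error e (tc e k) - zbar A J Q e k| < eta) ->
  (exists2 k, trig e k & tc e k < t) ->
  exists k, [/\ trig e k, tc e k < t &
    forall i, trig e i -> tc e i < t -> (i <= k)%N].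
Proof.
move=> A0 M0 etaJ ex lteta [k0 tk0 k0t].
pose tau := ln ((J + M / A) / (eta + M / A)) / A.
have tau0 : 0 < tau.
  case/andP: etaJ => eta0 etaJ.
  have MA0 : 0 < M / A by rewrite divr_gt0.
  by rewrite divr_gt0// ln_gt0// ltr_pdivlMr ?addr_gt0// mul1r ltrD2r.
pose P k := `[< trig e k /\ tc e k < t >].
have exP : exists k, P k by exists k0; apply/asboolP.
have ubP k : P k -> (k <= Num.trunc (t / tau))%N.
  move=> /asboolP[tk kt]; rewrite -ltnS -(ltr_nat R).
  apply: le_lt_trans (truncnS_gt (t / tau)).
  rewrite ler_pdivlMr//; apply: le_trans (ltW kt).
  exact: reception_ge ex lteta _ tk.
case: (ex_maxnP exP ubP) => k /asboolP[tk kt] kmax; exists k; split=> // i ti it.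
by apply: kmax; apply/asboolP.
Qed.

(** * Uniform bound on the estimation error *)

(** Here [s] stands for a time after the last reception preceding [t]. The last hypothesis says that
    a packet received from [s] on is still awaited at [t], and that nothing arrived between its
    triggering and [t]. *)
Lemma error_bound_from (R : realType) (A B M L gamma J : R)
    (Q : quantization_policy R) (e : signals R) (s t : R) :
  0 < A -> 0 < M -> 0 < J -> 0 <= gamma -> execution A B M L gamma J Q e ->
  0 <= s -> s <= t -> `|error e s| < J ->
  (forall k, trig e k -> s <= tc e k -> t <= tc e k /\ quiet e (ts e k) t) ->
  `|error e t| <= (J + M / A) * expR (A * gamma).
Proof.
move=> A0 M0 J0 g0 ex s0 st zsJ later.
have MA0 : 0 <= M / A by rewrite divr_ge0 ?ltW.
have [ztJ|Jzt] := ltP `|error e t| J.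
  apply: (le_trans (ltW ztJ)); apply: (@le_trans _ _ (J + M / A)).
    by rewrite lerDl.
  by rewrite ler_peMr ?addr_ge0 ?(ltW J0)// -expR0 ler_expR mulr_ge0// ltW.
have q : quiet e s t.
  by move=> k tk /andP[sk]; have [+ _] := later k tk sk; rewrite leNgt => /negP.
have cz : {within `[s, t], continuous (fun r => `|error e r|)}.
  apply: within_continuous_norm; apply: evolves_within_continuous st _ => r /andP[sr rt].
  apply: (error_evolves ex) => // k tk /andP[sk kr].
  by apply: (q k tk); rewrite sk (lt_le_trans kr).
(* The error is continuous on [[s, t]] and goes from below [J] to at least [J], so it meets the
   threshold at some [r]. The packet [k] in flight at [r] was sent when the error was exactly [J],
   at most [gamma] before [t]; growth is measured from [ts e k], not from [r]. *)
have [|r] := @IVT _ _ s t J st cz.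
  by rewrite ge_min (ltW zsJ) le_max Jzt orbT.
rewrite in_itv/= => /andP[sr rt] zrJ.
have [k tk /andP[kr rk]] := trigger_all ex (le_trans s0 sr) zrJ.
have [tle qk] := later k tk (le_trans sr rk).
have [ts0 tsJ] := trigger ex tk.
have := error_growth A0 ex ts0 (le_trans kr rt) qk; rewrite tsJ => growth.
apply: (@le_trans _ _ (`|error e t| + M / A)); first by rewrite lerDl.
apply: (le_trans growth); rewrite ler_wpM2l ?addr_ge0 ?(ltW J0)//.
rewrite ler_expR ler_pM2l// lerBlDl (le_trans tle)//.
by case/andP: (delay ex tk).
Qed.

Lemma error_bound (R : realType) (A B M L gamma J eta : R)
    (Q : quantization_policy R) (e : signals R) (t : R) :
  0 < A -> 0 < M -> 0 <= gamma -> 0 < eta < J ->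
  execution A B M L gamma J Q e -> `|error e 0| < J ->
  (forall k, trig e k -> `|error e (tc e k) - zbar A J Q e k| < eta) ->
  0 <= t -> `|error e t| <= (J + M / A) * expR (A * gamma).
Proof.
move=> A0 M0 g0 etaJ ex z0J lteta t0; have /andP[eta0 ltetaJ] := etaJ.
have J0 := lt_trans eta0 ltetaJ.
(* Without any reception before [t] the starting time is [0], where the error is below [J] by
   assumption; otherwise it is a time just after the last reception. *)
have [|none] := pselect (exists2 k, trig e k & tc e k < t); last first.
  have late k : trig e k -> t <= tc e k.
    by move=> tk; rewrite leNgt; apply/negP => kt; apply: none; exists k.
  apply: (error_bound_from A0 M0 J0 g0 ex (lexx 0) t0 z0J) => k tk _.
  split; first exact: late.
  by move=> i ti /andP[_]; rewrite ltNge late.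
move=> /(last_reception A0 M0 etaJ ex lteta)[m [tm mt mlast]].
have tcm0 : 0 <= tc e m.
  by have [/le_trans + _] := trigger ex tm; apply; case/andP: (delay ex tm).
near (tc e m)^'+ => s.
have ms : tc e m < s by near: s; exact: nbhs_right_gt.
have st : s < t by near: s; exact: nbhs_right_lt.
have zs : `|error e s| < eta.
  by near: s; exact: error_after_reception ex tm (lteta _ tm).
apply: (error_bound_from A0 M0 J0 g0 ex (le_trans tcm0 (ltW ms)) (ltW st)
  (lt_trans zs ltetaJ)) => k tk sk.
have mk : (m < k)%N.
  rewrite ltnNge; apply/negP => km; have := reception_mono ex km tm.
  by rewrite leNgt (lt_le_trans ms).
split.
  by rewrite leNgt; apply/negP => /(mlast _ tk); rewrite leqNgt mk.
(* A reception before [t] has index at most [m < k], so it precedes the triggering time [ts e k]. *)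
move=> i ti /andP[ki /(mlast _ ti) im].
have := reception_mono ex im tm.
by rewrite leNgt (lt_le_trans (reception_lt_trigger ex mk tk) ki).
Unshelve. all: by end_near. Qed.

(** * The closed loop under linear feedback *)

(** The closed loop reads [x' = - (B K - A) x + (B K z + w)] with forcing at most [F]. At distance
    [kappa] or more from the origin the decay dominates the forcing, so [kappa] and [- kappa] are
    barriers; the summand [L] of [kappa] places the initial state between them. *)
Lemma state_bound (R : realType) (A B M L gamma J K D : R)
    (Q : quantization_policy R) (e : signals R) (t : R) :
  A - B * K < 0 -> 0 <= L -> 0 <= M -> 0 <= D ->
  execution A B M L gamma J Q e ->
  (forall r, 0 <= r -> input e r = - (K * estimate e r)) ->
  (forall r, 0 <= r -> `|error e r| <= D) ->
  0 <= t -> `|state e t| <= L + (`|B * K| * D + M) / (B * K - A).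
Proof.
move=> a0 L0 M0 D0 ex inp zD t0.
have {}a0 : 0 < B * K - A by rewrite subr_gt0 -subr_lt0.
set F := _ * D + M; set kappa := L + _.
have kap0 : 0 <= F / (B * K - A).
  apply: divr_ge0; last exact: ltW.
  by rewrite addr_ge0 ?mulr_ge0.
have kapF : F <= (B * K - A) * kappa.
  by rewrite mulrDr mulrCA divff ?gt_eqF// mulr1 lerDr mulr_ge0// ltW.
have dE r : 0 <= r -> A * state e r + B * input e r + noise e r =
    - ((B * K - A) * state e r) + (B * K * error e r + noise e r).
  by move=> r0; rewrite inp// /error; ring.
have dF r : 0 <= r -> `|B * K * error e r + noise e r| <= F.
  move=> r0; apply: (le_trans (ler_normD _ _)); apply: lerD.
    by rewrite normrM ler_wpM2l// zD.
  exact: (disturbance_bounded ex).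
have x0 : `|state e 0| <= kappa by rewrite (le_trans (initial_state ex))// lerDl.
have drift r x : kappa <= x -> 0 <= r ->
    `|B * K * error e r + noise e r| <= (B * K - A) * x.
  move=> kx r0; apply: (le_trans (dF _ r0)); apply: (le_trans kapF).
  by rewrite ler_pM2l.
(* The lower bound is the upper barrier applied to the opposite of the state. *)
rewrite ler_norml; apply/andP; split.
  rewrite lerNl; apply: (evolves_barrier (y := fun r => - state e r)
    (f := fun r => - (A * state e r + B * input e r + noise e r)) t0).
  - by move=> p r p0 pr _; exact/evolves_opp/(plant ex).
  - move=> r /andP[r0 _] /drift /(_ r0); rewrite dE//.
    by rewrite ler_norml => /andP[]; lra.
  - by rewrite lerNl; move: x0; rewrite ler_norml => /andP[].
apply: (evolves_barrier (y := state e)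
  (f := fun r => A * state e r + B * input e r + noise e r) t0).
- by move=> p r p0 pr _; exact: (plant ex).
- move=> r /andP[r0 _] /drift /(_ r0); rewrite dE//.
  by rewrite ler_norml => /andP[]; lra.
- by move: x0; rewrite ler_norml => /andP[].
Qed.

Theorem theorem2 (R : realType) (A B M L gamma J rho0 b : R)
    (Q : quantization_policy R) :
  0 < A -> 0 < M -> 0 < L -> 0 <= gamma -> 0 < J -> 0 < rho0 < 1 -> 1 < b ->
  stabilizable A B ->
  M / (A * rho0) * (expR (A * gamma) - 1) < J ->
  achieves A B M L gamma J rho0 b Q ->
  exists2 phi : R -> R, lipschitz phi &
  exists T0 kappa : R, 0 <= T0 /\
  forall e : signals R, execution A B M L gamma J Q e ->
    `|error e 0| < J ->
    packets_large_enough A M gamma J rho0 b e ->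
    (forall t, 0 <= t -> input e t = phi (estimate e t)) ->
    forall t, T0 <= t -> `|state e t| <= kappa.
Proof.
move=> A0 M0 L0 g0 J0 /andP[rho0_gt0 rho0_lt1] _ [K a0] _ ach.
(* The gain is the one supplied by stabilizability, and [|K|] is a Lipschitz constant of the
   feedback. *)
exists (fun r => - (K * r)).
  exists `|K|; split; first exact: num_real.
  move=> k Kk [x y] _ /=.
  by rewrite -opprD normrN -mulrBr normrM ler_wpM2r// ltW.
pose D := (J + M / A) * expR (A * gamma).
(* The bound holds from time [0] on, since [kappa] already accounts for the initial state. *)
exists 0, (L + (`|B * K| * D + M) / (B * K - A)); split=> // e ex z0J large inp t t0.
(* The policy gives the non-strict bound [rho0 * J], while the error lemmas need a strict bound by
   some [eta < J]; the midpoint of [rho0 * J] and [J] serves as [eta]. *)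
have etaJ : 0 < (rho0 + 1) / 2 * J < J.
  by apply/andP; split; nra.
have lteta k : trig e k -> `|error e (tc e k) - zbar A J Q e k| < (rho0 + 1) / 2 * J.
  by move=> tk; apply: (le_lt_trans (ach e ex z0J large k tk)); nra.
have D0 : 0 <= D by rewrite ltW// mulr_gt0 ?expR_gt0 ?addr_gt0 ?divr_gt0.
apply: (state_bound a0 (ltW L0) (ltW M0) D0 ex inp _ t0) => r r0.
exact: (error_bound A0 M0 g0 etaJ ex z0J lteta r0).
Qed.
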